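(* Let $(L,\Box)$ be a complete necessity lattice with $\Box$ completely multiplicative, and let $P$ be a separating set of pairs of elements of $L$. Let $\vartriangleleft$ be the relation on $P$ given by $(a,b)\vartriangleleft(c,d)$ iff $c\not\leq b$, and let $R$ be the relation on $P$ given by $(x,x')R(y,y')$ iff $y\leq\bigwedge\{a\in L\mid x\leq\Box a\}$. Then $(P,\vartriangleleft,R)$ is a CA frame and $(L,\Box)$ is isomorphic to $(\mathfrak{L}(P,\vartriangleleft),\Box_R)$.
   Context: A relational frame is a pair $(X,\vartriangleleft)$ with $X$ a nonempty set and $\vartriangleleft$ a binary relation on $X$; it is a compatibility frame if $\vartriangleleft$ is reflexive. Write $y\vartriangleright x$ for $x\vartriangleleft y$, and for $A\subseteq X$ let $c_\vartriangleleft(A)=\{x\in X\mid \forall x'\vartriangleleft x\ \exists x''\vartriangleright x':\ x''\in A\}$. This is a closure operator on $\wp(X)$. A $c_\vartriangleleft$-fixpoint is an $A\subseteq X$ with $c_\vartriangleleft(A)=A$. $\mathfrak{L}(X,\vartriangleleft)$ is the complete lattice of $c_\vartriangleleft$-fixpoints ordered by $\subseteq$ (meets are intersections; $\bigvee A_i=c_\vartriangleleft(\bigcup A_i)$). A necessity lattice is a pair $(L,\Box)$ with $L$ a lattice and $\Box$ a unary operation with $\Box(a\wedge b)=\Box a\wedge\Box b$ for all $a,b$, and $\Box1=1$ if $L$ has a maximum $1$; it is complete if $L$ is. $\Box$ is completely multiplicative if for any $A\subseteq L$ such that $\bigwedge A$ exists, $\Box\bigwedge A=\bigwedge\{\Box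 a\mid a\in A\}$. A set $P$ of pairs of elements of $L$, with the relation $(a,b)\vartriangleleft(c,d)$ iff $c\not\leq b$ on $P$, is separating if for all $a,b\in L$: (1) if $a\not\leq b$, then there is $(c,d)\in P$ with $c\leq a$ and $c\not\leq b$; (2) for all $(c,d)\in P$, if $c\not\leq b$, then there is $(c',d')\in P$ with $(c',d')\vartriangleleft(c,d)$ such that for all $(c'',d'')\in P$ with $(c',d')\vartriangleleft(c'',d'')$, $c''\not\leq b$. A compatibility and accessibility (CA) frame is a triple $(X,\vartriangleleft,R)$ where $(X,\vartriangleleft)$ is a compatibility frame and $R$ is a binary relation on $X$ such that for every $c_\vartriangleleft$-fixpoint $A\subseteq X$, the set $\Box_R A=\{x\in X\mid R(x)\subseteq A\}$ is also a $c_\vartriangleleft$-fixpoint, where $R(x)=\{y\in X\mid xRy\}$.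
   Formalization: ''(P,◁,R) is a CA frame'' is proved assuming P is nonempty and ◁ is reflexive on P, which separation does not imply (L={0,1}, P={(1,0),(0,1)}); that □_R preserves fixpoints and the isomorphism are proved for every separating P. *)

(* Defs.v *)
From HB Require Import structures.
From mathcomp Require Import all_boot all_order.
From mathcomp Require Import mathcomp_extra boolp classical_sets.

Set Implicit Arguments.
Unset Strict Implicit.
Unset Printing Implicit Defensive.

Import Order.TTheory.
Local Open Scope classical_set_scope.
Local Open Scope order_scope.

(* A frame relation [tri x y] is read x ◁ y. *)
Section Frames.
Variables (X : Type) (tri : X -> X -> Prop).

Definition compatibility_frame : Prop :=
  inhabited X /\ forall x, tri x x.

Definition cl (A : set X) : set X :=
  [set x | forall x', tri x' x -> exists2 x'', tri x' x'' & A x''].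

Definition box_rel (R : X -> X -> Prop) (A : set X) : set X :=
  [set x | [set y | R x y] `<=` A].

Definition box_stable (R : X -> X -> Prop) : Prop :=
  forall A : set X, cl A = A -> cl (box_rel R A) = box_rel R A.

Definition CA_frame (R : X -> X -> Prop) : Prop :=
  compatibility_frame /\ box_stable R.

Lemma cl_ext A : A `<=` cl A.
Proof. by move=> x Ax x' x'x; exists x. Qed.

Lemma cl_mono A B : A `<=` B -> cl A `<=` cl B.
Proof.
by move=> AB x cAx x' /cAx[x'' x'x'' Ax'']; exists x'' => //; apply: AB.
Qed.

Lemma cl_idem A : cl (cl A) = cl A.
Proof.
apply/seteqP; split=> [x ccAx x' /ccAx[y x'y]|]; last exact: cl_ext.
by move=> /(_ _ x'y).
Qed.

Lemma cl_setI A B : cl A = A -> cl B = B -> cl (A `&` B) = A `&` B.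
Proof.
move=> cA cB; apply/seteqP; split=> [x cABx|]; last exact: cl_ext.
by split; [rewrite -cA|rewrite -cB]; apply: cl_mono cABx => y [].
Qed.

Record fixpoints := MkFixpoint {
  fix_set :> set X;
  fix_setP : cl fix_set == fix_set }.

HB.instance Definition _ := [isSub for fix_set].
HB.instance Definition _ := [Choice of fixpoints by <:].
HB.instance Definition _ :=
  [SubChoice_isSubPOrder of fixpoints by <: with set_display].

Lemma fix_clE (A : fixpoints) : cl A = A.
Proof. exact/eqP/fix_setP. Qed.

Lemma le_fixE (A B : fixpoints) : (A <= B) = `[< A `<=` B >].
Proof. by apply/idP/asboolP => /subsetPset. Qed.

Definition fix_meet (A B : fixpoints) : fixpoints :=
  MkFixpoint (introT eqP (cl_setI (fix_clE A) (fix_clE B))).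

Definition fix_join (A B : fixpoints) : fixpoints :=
  MkFixpoint (introT eqP (cl_idem (A `|` B))).

Lemma fix_lexI (A B C : fixpoints) :
  (A <= fix_meet B C) = (A <= B) && (A <= C).
Proof.
rewrite !le_fixE; apply/asboolP/andP => [ABC|[/asboolP AB /asboolP AC]].
  by split; apply/asboolP => x /ABC[].
by move=> x Ax; split; [apply: AB|apply: AC].
Qed.

Lemma fix_leUx (A B C : fixpoints) :
  (fix_join A B <= C) = (A <= C) && (B <= C).
Proof.
rewrite !le_fixE; apply/asboolP/andP => [ABC|[/asboolP AC /asboolP BC]].
  by split; apply/asboolP => x ?; apply/ABC/cl_ext; [left|right].
by rewrite -[X in _ `<=` X](fix_clE C); apply: cl_mono => x [/AC|/BC].
Qed.

HB.instance Definition _ :=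
  Order.POrder_MeetJoin_isLattice.Build set_display fixpoints
    fix_lexI fix_leUx.

Definition fix_box (R : X -> X -> Prop) (HR : box_stable R)
    (A : fixpoints) : fixpoints :=
  MkFixpoint (introT eqP (HR A (fix_clE A))).

End Frames.

Section NecessityLattices.
Variables (d : Order.disp_t) (L : latticeType d).

Definition complete_lattice : Prop :=
  forall A : set L, infimums A !=set0 /\ supremums A !=set0.

(* [infimum] of classical_sets returns its default value on the empty set,
   where the meet has to be the maximum of [L]. *)
Definition bigmeet (cL : complete_lattice) (A : set L) : L :=
  sval (cid (cL A).1).

Definition necessity (box : L -> L) : Prop :=
  {morph box : a b / (a `&` b)%O} /\
  (forall t : L, ubound setT t -> box t = t).

Definition completely_multiplicative (box : L -> L) : Prop :=
  forall (A : set L) (m : L), infimums A m -> infimums (box @` A) (box m).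

Section Pairs.
Variable P : set (L * L).

Definition pair_tri (p q : P) : Prop := ~ ((val q).1 <= (val p).2).

Definition separating : Prop := forall a b : L,
  (~ (a <= b) -> exists p : P, (val p).1 <= a /\ ~ ((val p).1 <= b)) /\
  (forall p : P, ~ ((val p).1 <= b) ->
    exists2 p' : P, pair_tri p' p &
      forall p'' : P, pair_tri p' p'' -> ~ ((val p'').1 <= b)).

Definition pair_acc (cL : complete_lattice) (box : L -> L) (p q : P) : Prop :=
  (val q).1 <= bigmeet cL [set a | (val p).1 <= box a].

End Pairs.
End NecessityLattices.

Definition necessity_isomorphic (d d' : Order.disp_t) (L : latticeType d)
    (M : latticeType d') (boxL : L -> L) (boxM : M -> M) : Prop :=
  exists f : L -> M,
    [/\ bijective f,
        {morph f : a b / (a `&` b)%O},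
        {morph f : a b / (a `|` b)%O} &
        {morph f : a / boxL a >-> boxM a}].

(* Main.v *)
Require Import Defs.
From mathcomp Require Import all_boot all_order.
From mathcomp Require Import mathcomp_extra boolp classical_sets.

(** The isomorphism sends [a] to the set [below a] of pairs of [P] whose first
    component lies below [a].  Clause (2) of separation says exactly that a
    pair outside [below a] is outside its closure, so [below a] is a fixpoint;
    clause (1) says that the first components are join-dense in [L], so
    [below] is an order embedding.  It is onto the fixpoints because a fixpoint
    [A] equals [below s] for [s] the supremum of its first components
    ([fixpoint_below_sup]): a pair [p'] related to no member of [A] has a
    second component bounding all of them, hence also bounding [s].

    For the modality, the meet [m] of all [a] with [p.1 <= box a] satisfies
    [p.1 <= box m] because [box] is completely multiplicative.  So
    [p.1 <= box a] holds iff [m <= a], which, by join-density, holds iff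
    every pair accessible from [p] belongs to [below a] ([box_rel_below]).
    Since every fixpoint is some [below a], this both makes [box_rel]
    preserve fixpoints and makes [below] commute with the modalities. *)

Set Implicit Arguments.
Unset Strict Implicit.
Unset Printing Implicit Defensive.

Import Order.TTheory.
Local Open Scope classical_set_scope.
Local Open Scope order_scope.

Lemma supremums_lub (d : Order.disp_t) (L : latticeType d) (A : set L) (s u : L) :
  supremums A s -> (s <= u <-> ubound A u).
Proof.
move=> [As lubs]; split=> [su x Ax|]; last exact: lubs.
exact: le_trans (As _ Ax) su.
Qed.

Lemma bigmeet_inf (d : Order.disp_t) (L : latticeType d)
    (cL : complete_lattice L) (A : set L) : infimums A (bigmeet cL A).
Proof. by rewrite /bigmeet; case: cid. Qed.

(** The meet [m] of [{b | x <= box b}] is the value at [x] of a left adjoint of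
    [box]; such an adjoint exists because [box] preserves all meets. *)
Lemma le_box_adjoint (d : Order.disp_t) (L : latticeType d) (box : L -> L)
    (cL : complete_lattice L) (box_nec : necessity box)
    (box_mul : completely_multiplicative box) (x a : L) :
  (x <= box a) = (bigmeet cL [set b | x <= box b] <= a).
Proof.
have inf_m := bigmeet_inf cL [set b | x <= box b].
apply/idP/idP => [xa|ma]; first exact: inf_m.1.
have [_ glb] := box_mul _ _ inf_m.
apply: (@le_trans _ _ (box (bigmeet cL [set b | x <= box b]))).
  by apply: glb => _ [b xb <-].
by apply/meet_idPl; rewrite -box_nec.1 (meet_idPl ma).
Qed.

Section Representation.
Variables (d : Order.disp_t) (L : latticeType d) (P : set (L * L)).
Hypothesis P_sep : separating P.

Notation tri := (@pair_tri d L P).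

Definition below (a : L) : set P := [set p | (val p).1 <= a].

Lemma cl_below (a : L) : cl tri (below a) = below a.
Proof.
apply/seteqP; split=> [p clp|]; last exact: cl_ext.
apply: contrapT => pa.
have [p' p'p far] := (P_sep a a).2 p pa.
by have [q p'q qa] := clp p' p'p; apply: far p'q qa.
Qed.

Lemma sub_below (a b : L) : below a `<=` below b <-> a <= b.
Proof.
split=> [ab|ab p pa]; last exact: le_trans pa ab.
apply: contrapT => nab.
by have [p [pa]] := (P_sep a b).1 nab; apply; exact: ab.
Qed.

Lemma fixpoint_below_sup (A : set P) (s : L) :
  cl tri A = A -> supremums [set (val p).1 | p in A] s -> A = below s.
Proof.
move=> clA sup_s; apply/seteqP; split=> [p Ap|p ps].
  by apply: sup_s.1; exists p.
rewrite -clA => p' p'p.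
(* Otherwise the second component of [p'] bounds all first components in [A],
   hence bounds [s] and the first component of [p]. *)
apply: contrapT => noq; apply: p'p; apply: le_trans ps _.
apply/(supremums_lub _ sup_s) => _ [q Aq <-].
by apply: contrapT => p'q; apply: noq; exists q.
Qed.

Lemma fixpoint_belowP (cL : complete_lattice L) (A : set P) :
  cl tri A = A -> exists a, A = below a.
Proof.
move=> clA; have [_ [s sup_s]] := cL [set (val p).1 | p in A].
by exists s; apply: fixpoint_below_sup.
Qed.

Definition below_fix (a : L) : fixpoints tri :=
  MkFixpoint (introT eqP (cl_below a)).

Lemma le_below_fix (a b : L) : (below_fix a <= below_fix b) = (a <= b).
Proof. by rewrite le_fixE; apply/asboolP/idP => /sub_below. Qed.

Lemma below_fix_surj (cL : complete_lattice L) (A : fixpoints tri) :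
  exists a, below_fix a = A.
Proof.
have [a Aa] := fixpoint_belowP cL (fix_clE A).
by exists a; apply: val_inj; rewrite /= Aa.
Qed.

Lemma below_fix_bij (cL : complete_lattice L) : bijective below_fix.
Proof.
have [g gK] := choice (below_fix_surj cL).
exists g => // a; apply/eqP.
by rewrite eq_le -!le_below_fix gK lexx.
Qed.

Lemma below_fixI : {morph below_fix : a b / a `&` b}.
Proof.
move=> a b; apply: val_inj; apply/seteqP; split=> p /=.
  by rewrite /below /= lexI => /andP.
by move=> pab; rewrite /below /= lexI; apply/andP.
Qed.

Lemma below_fixU (cL : complete_lattice L) : {morph below_fix : a b / a `|` b}.
Proof.
move=> a b; apply/le_anti/andP; split; last first.
  by rewrite leUx !le_below_fix leUl leUr.
(* By surjectivity the join of the images is itself an image [below_fix c]. *)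
have [c cE] := below_fix_surj cL (below_fix a `|` below_fix b).
by rewrite -cE le_below_fix leUx -!le_below_fix cE leUl leUr.
Qed.

Section Modality.
Variables (box : L -> L) (cL : complete_lattice L).
Hypothesis box_nec : necessity box.
Hypothesis box_mul : completely_multiplicative box.

Notation acc := (@pair_acc d L P cL box).

(** The successors of [p] form [below m], with [m] the left adjoint of [box] at
    the first component of [p]. *)
Lemma box_rel_below (a : L) : box_rel acc (below a) = below (box a).
Proof.
apply/seteqP; split=> p; rewrite /below /= (le_box_adjoint cL) //.
  by move/sub_below.
by move=> ma; apply/sub_below.
Qed.

Lemma box_stable_acc : box_stable tri acc.
Proof.
by move=> A /(fixpoint_belowP cL)[a ->]; rewrite box_rel_below cl_below.
Qed.

End Modality.

End Representation.

(* With the definitions as given, a separating [P] may contain pairs [(a, b)]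
   with [a <= b] and may be empty (when [L] is trivial); then [(P, pair_tri P)]
   is not a compatibility frame, hence the guard on the first conjunct.  The
   rest holds for every separating [P]. *)
Theorem proposition4p8 (d : Order.disp_t) (L : latticeType d) (box : L -> L)
    (cL : complete_lattice L) (box_nec : necessity box)
    (box_mul : completely_multiplicative box)
    (P : set (L * L)) (P_sep : separating P) :
  exists HR : box_stable (@pair_tri d L P) (@pair_acc d L P cL box),
    (compatibility_frame (@pair_tri d L P) ->
       CA_frame (@pair_tri d L P) (@pair_acc d L P cL box)) /\
    necessity_isomorphic box (fix_box HR).
Proof.
have HR := box_stable_acc P_sep cL box_nec box_mul.
exists HR; split=> //; exists (below_fix P_sep); split.
- exact: below_fix_bij.
- exact: below_fixI.
- exact: below_fixU.
- by move=> a; apply: val_inj; rewrite /= box_rel_below.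
Qed.
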